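(* Let $k\ge0$ and $\mathbf n=(n_1,\dots,n_r)$ with $1=n_1=\dots=n_s<n_{s+1}\le\dots\le n_r$ (where $0\le s\le r$). Then \[ \delta_{pr}(k,\mathbf n)\le\begin{cases}2(k+r)-s-t & \text{if } 3s\le 2k+2r,\\ 2(k+r-s)+1 & \text{if } 3s=2k+2r+1,\\ 2(k+r-s+1) & \text{if } 3s\ge 2k+2r+2,\end{cases} \] where, in the first case, $t\in\{s,\dots,r\}$ is maximal such that $3s+\sum_{i=s+1}^t(n_i+1)\le 2k+2r$.
   Context: $\Delta_m$ denotes the $m$-dimensional simplex; for $\mathbf n=(n_1,\dots,n_r)$, $\Delta_{\mathbf n}:=\Delta_{n_1}\times\dots\times\Delta_{n_r}$. The $k$-skeleton of a polytope is the poset of its faces of dimension at most $k$; two $k$-skeleta are combinatorially equivalent if these posets are isomorphic. A convex polytope is $(k,\mathbf n)$-PSN if its $k$-skeleton is combinatorially equivalent to that of $\Delta_{\mathbf n}$, and $(k,\mathbf n)$-PPSN if in addition it is the image under a linear projection of a polytope combinatorially equivalent to $\Delta_{\mathbf n}$. $\delta_{pr}(k,\mathbf n)$ is the smallest dimension of a $(k,\mathbf n)$-PPSN polytope. *)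

(* Defs.v *)
From HB Require Import structures.
From mathcomp Require Import all_boot all_order all_algebra.
Set Implicit Arguments. Unset Strict Implicit. Unset Printing Implicit Defensive.
Import Order.TTheory GRing.Theory Num.Theory.
Local Open Scope ring_scope.

(* A polytope P in R^d is given as conv(v(T)) for a finite family of points
   v : T -> 'rV_d (not necessarily all vertices).  Every face F of P is
   conv of the points v x lying in F, so faces are in bijection with the
   "exposed" index sets { x | v x in F }: the sets cut out by a valid
   inequality c.x <= b (c = 0, b = 1 gives the empty face, c = 0, b = 0
   gives P itself).  Inclusion of faces = inclusion of index sets. *)
Definition is_face (R : realFieldType) (d : nat) (T : finType)
  (v : T -> 'rV[R]_d) (S : {set T}) : Prop :=
  exists (c : 'cV[R]_d) (b : R),
    forall x : T, ((v x *m c) 0 0 <= b) /\ (x \in S <-> (v x *m c) 0 0 = b).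

(* affine dimension of conv { v x | x in S } (= -1 for the empty set) *)
Definition affdim (R : realFieldType) (d : nat) (T : finType)
  (v : T -> 'rV[R]_d) (S : {set T}) : int :=
  (\rank (\matrix_(i < #|T|)
      (if enum_val i \in S then row_mx (v (enum_val i)) (1 : 'rV[R]_1)
       else 0)))%:Z - 1.

Definition skel_face (R : realFieldType) (d : nat) (T : finType)
  (v : T -> 'rV[R]_d) (k : int) (S : {set T}) : Prop :=
  is_face v S /\ affdim v S <= k.

Definition poset_iso (T T' : finType) (F : {set T} -> Prop)
  (F' : {set T'} -> Prop) : Prop :=
  exists f : {set T} -> {set T'},
    [/\ forall S, F S -> F' (f S),
        forall S', F' S' -> exists2 S, F S & f S = S' &
        forall S1 S2, F S1 -> F S2 -> (S1 \subset S2) = (f S1 \subset f S2)].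

Definition skel_equiv (R : realFieldType) (d d' : nat) (T T' : finType)
  (v : T -> 'rV[R]_d) (v' : T' -> 'rV[R]_d') (k : int) : Prop :=
  poset_iso (skel_face v k) (skel_face v' k).

Definition comb_equiv (R : realFieldType) (d d' : nat) (T T' : finType)
  (v : T -> 'rV[R]_d) (v' : T' -> 'rV[R]_d') : Prop :=
  poset_iso (is_face v) (is_face v').

(* The standard realization of Delta_n = Delta_{n_1} x ... x Delta_{n_r}:
   Delta_m = conv(e_0,...,e_m) in R^{m+1}; the product lives in
   R^{sum (n_i+1)}, coordinates indexed by pairs (i, j), j <= n_i,
   vertices indexed by choice functions f with f i <= n i. *)
Definition DProd_idx (r : nat) (n : 'I_r -> nat) : finType :=
  {dffun forall i : 'I_r, 'I_(n i).+1}.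
Definition DProd_coord (r : nat) (n : 'I_r -> nat) : finType :=
  {i : 'I_r & 'I_(n i).+1}.
Definition DProd_dim (r : nat) (n : 'I_r -> nat) : nat :=
  #|DProd_coord n|.
Definition DProd_pt (R : realFieldType) (r : nat) (n : 'I_r -> nat)
  (f : DProd_idx n) : 'rV[R]_(DProd_dim n) :=
  \row_(j < DProd_dim n)
    (let p := @enum_val (DProd_coord n) predT j in
     (nat_of_bool (val (f (tag p)) == val (tagged p)))%:R).

(* (k,n)-PPSN polytope in R^d: P = pi(Q) with Q = conv(w(T)) combinatorially
   equivalent to Delta_n, pi linear (matrix A), and the k-skeleton of P
   combinatorially equivalent to that of Delta_n. *)
Definition ppsn_in_dim (R : realFieldType) (k : nat) (r : nat)
  (n : 'I_r -> nat) (d : nat) : Prop :=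
  exists (e : nat) (T : finType) (w : T -> 'rV[R]_e) (A : 'M[R]_(e, d)),
    comb_equiv w (@DProd_pt R r n) /\
    skel_equiv (fun x => w x *m A) (@DProd_pt R r n) k%:Z.

Definition delta_pr_le (R : realFieldType) (k r : nat) (n : 'I_r -> nat)
  (D : nat) : Prop :=
  exists d : nat, (d <= D)%N /\ ppsn_in_dim R k n d.

Definition t_cond (k r s : nat) (n : 'I_r -> nat) (t : nat) : bool :=
  (3 * s + \sum_(i < r | (s <= i)%N && (i < t)%N) (n i).+1 <= 2 * k + 2 * r)%N.

(* Main.v *)
Require Import Defs.
From mathcomp Require Import all_boot all_order all_algebra.
From mathcomp Require Import zify ring lra.

(** Describe a polytope by the slacks of its facets, that is by points with one
    coordinate for each vertex [(i, j)] of a factor, positive exactly at the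
    [r] coordinates [(i, f i)]. If these points satisfy [r] linear equations
    [C_i = b_i] where [C_i] is positive on block [i] and otherwise supported on
    blocks of lower level (a deformed product), their convex hull is
    combinatorially a product of simplices. Projecting along a complement of
    the [C_i] in a space [V] of functions on the coordinates preserves a face as
    soon as [V] contains a nonnegative function vanishing exactly on the
    coordinates used by that face. So [d + r] bounds the dimension of [V], and
    it suffices to find a small [V] for faces using at most [k + r] coordinates.

    Take for [V] the polynomials of degree at most [m = 2(k + r - s)] evaluated
    at points of a line, both ends of a segment sharing one point, plus
    corrections that are constant on simplex blocks and antisymmetric on
    segments. The square of a product over the [<= k + r - s] coordinates that
    remain after discarding one end of every segment gives the required
    nonnegative function. When there are few segments and small simplices, the
    [C_i] of those blocks are polynomials by interpolation, which makes their
    corrections unnecessary. When there are many segments, each segment is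
    instead coupled to its predecessor by an infinitesimal term. *)

Set Implicit Arguments. Unset Strict Implicit. Unset Printing Implicit Defensive.
Import Order.TTheory GRing.Theory Num.Theory.

(** * Affine dimension and boxes *)

Section AffineDimension.
Variables (R : realFieldType) (d : nat) (T : finType) (v : T -> 'rV[R]_d).
Implicit Types S : {set T}.
Local Open Scope ring_scope.

Definition homog_mx (S : {set T}) : 'M[R]_(#|T|, d + 1) :=
  \matrix_(i < #|T|)
    (if enum_val i \in S then row_mx (v (enum_val i)) (1 : 'rV[R]_1) else 0).

Lemma sub_homog_mx S x : x \in S -> (row_mx (v x) 1 <= homog_mx S)%MS.
Proof.
move=> xS; suff -> : row_mx (v x) 1 = row (enum_rank x) (homog_mx S).
  exact: row_sub.
by rewrite rowK enum_rankK xS.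
Qed.

Lemma homog_mx_sub S m (B : 'M_(m, d + 1)) :
  (forall x, x \in S -> (row_mx (v x) 1 <= B)%MS) -> (homog_mx S <= B)%MS.
Proof.
move=> h; apply/row_subP=> i; rewrite rowK.
by case: ifP => [/h //|_]; apply: sub0mx.
Qed.

Lemma affdim_rank S : affdim v S = (\rank (homog_mx S))%:Z - 1.
Proof. by []. Qed.

Lemma affdim_subset S1 S2 : S1 \subset S2 -> affdim v S1 <= affdim v S2.
Proof.
move=> s12; rewrite !affdim_rank lerD2r lez_nat; apply: mxrankS.
by apply: homog_mx_sub => x /(subsetP s12); apply: sub_homog_mx.
Qed.

Lemma affdim_set0 : affdim v set0 = -1.
Proof.
rewrite affdim_rank (_ : homog_mx set0 = 0) ?mxrank0 //.
by apply/row_matrixP=> i; rewrite rowK row0 inE.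
Qed.

Lemma affdim_ge0 S x : x \in S -> 0 <= affdim v S.
Proof.
move=> xS; rewrite affdim_rank subr_ge0 lez_nat lt0n mxrank_eq0.
apply/eqP => h; have := sub_homog_mx xS; rewrite h => /submx0null.
move/(congr1 rsubmx); rewrite row_mxKr => /matrixP/(_ 0 0)/eqP.
by rewrite !mxE oner_eq0.
Qed.

(** The homogenized inequality cutting out [S1] kills every row of [homog_mx S1] but not the row of
    a point of [S2] outside [S1], so the ranks differ. *)
Lemma affdim_face_proper S1 S2 : is_face v S1 -> S1 \proper S2 ->
  affdim v S1 + 1 <= affdim v S2.
Proof.
move=> [c [b hf]] /properP[s12 [x xS2 xS1]].
pose y : 'cV[R]_(d + 1) := col_mx c (const_mx (- b)).
have yE z : (row_mx (v z) 1 *m y) = const_mx ((v z *m c) 0 0 - b).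
  rewrite mul_row_col mul1mx; apply/matrixP=> i j.
  by rewrite !ord1 !mxE.
have y1 : homog_mx S1 *m y = 0.
  apply/row_matrixP=> i; rewrite row_mul rowK row0; case: ifP => [iS|_];
    last exact: mul0mx.
  by rewrite yE; have [_ [-> // _]] := hf (enum_val i); rewrite subrr;
    apply/matrixP=> ? ?; rewrite !mxE.
have sub : (homog_mx S1 <= homog_mx S2)%MS.
  by apply: homog_mx_sub => z /(subsetP s12); apply: sub_homog_mx.
rewrite !affdim_rank addrAC lerD2r -PoszD addn1 lez_nat ltn_neqAle.
rewrite (mxrankS sub) andbT; apply/negP => /eqP req.
have /eqmxP eqs : (homog_mx S1 == homog_mx S2)%MS.
  by rewrite sub /= -(mxrank_leqif_sup sub) req.
have : (row_mx (v x) 1 <= homog_mx S1)%MS by rewrite eqs; apply: sub_homog_mx.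
move=> /submxP[D /(congr1 (mulmx^~ y))]; rewrite yE -mulmxA y1 mulmx0.
move=> /matrixP/(_ 0 0); rewrite !mxE => /eqP; rewrite subr_eq0 => /eqP xb.
by case: (hf x) => _ [_ h]; move: xS1; rewrite h // mxE.
Qed.

Lemma affdim_mulmx d' (A : 'M_(d, d')) S :
  (\rank (\matrix_(i < #|T|)
      (if enum_val i \in S then row_mx (v (enum_val i) *m A) (1 : 'rV[R]_1)
       else 0)))%:Z - 1 <= affdim v S.
Proof.
rewrite affdim_rank lerD2r lez_nat.
suff -> : (\matrix_(i < #|T|)
      (if enum_val i \in S then row_mx (v (enum_val i) *m A) (1 : 'rV[R]_1)
       else 0)) = homog_mx S *m block_mx A 0 0 1 by apply: mxrankM_maxl.
apply/row_matrixP=> i; rewrite row_mul !rowK.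
by case: ifP => _; rewrite ?mul0mx // mul_row_block !mulmx0 mulmx1 addr0 add0r.
Qed.

End AffineDimension.

Section Boxes.
Variables (r : nat) (n : 'I_r -> nat).
Local Notation idx := (DProd_idx n).
Local Notation coord := (DProd_coord n).
Implicit Types (I J : {set coord}) (f : idx) (q : coord).

Definition vtx (f : idx) (i : 'I_r) : coord := Tagged (fun i => 'I_(n i).+1) (f i).

(** [I] lists the vertices kept in each factor, so boxes are the faces of the product; a box is
    empty as soon as [I] misses a block. *)
Definition box (I : {set coord}) : {set idx} := [set f | [forall i, vtx f i \in I]].

Definition meets_blocks (I : {set coord}) : bool :=
  [forall i, [exists q in I, tag q == i]].

Lemma boxP I f : reflect (forall i, vtx f i \in I) (f \in box I).
Proof. by rewrite inE; apply: forallP. Qed.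

Definition upd (f : idx) (q : coord) : idx :=
  [ffun i => dfwith (fun i => f i) (tagged q) i].

Lemma vtx_upd f q : vtx (upd f q) (tag q) = q.
Proof. by rewrite /vtx ffunE dfwith_in; case: q. Qed.

Lemma vtx_upd_neq f q i : i != tag q -> vtx (upd f q) i = vtx f i.
Proof. by move=> iq; rewrite /vtx ffunE dfwith_out // eq_sym. Qed.

Lemma vtx_inj f : injective (vtx f).
Proof. by move=> i j /(congr1 tag). Qed.

Lemma vtx_ex (P : coord -> Prop) :
  (forall i, exists2 q, tag q = i & P q) -> exists f, forall i, P (vtx f i).
Proof.
move=> h.
have h' i : exists j : 'I_(n i).+1, P (Tagged _ j).
  by have [[i' j] /= <- Pq] := h i; exists j.
have [g gP] := fin_all_exists h'; exists (finfun g : idx) => i.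
by rewrite /vtx ffunE.
Qed.

Lemma box_vertex I q : meets_blocks I -> q \in I ->
  exists2 f, f \in box I & vtx f (tag q) = q.
Proof.
move=> /forallP mI qI.
have [|f fI] := @vtx_ex (fun q => q \in I).
  by move=> i; have /exists_inP[q' ? /eqP] := mI i; exists q'.
exists (upd f q); last exact: vtx_upd.
apply/boxP => i; have [->|iq] := eqVneq i (tag q); first by rewrite vtx_upd.
by rewrite vtx_upd_neq.
Qed.

Lemma box_proper I q : meets_blocks I -> q \in I -> box (I :\ q) \proper box I.
Proof.
move=> mI qI; apply/properP; split.
  by apply/subsetP=> f /boxP h; apply/boxP=> i; have /setD1P[] := h i.
have [f fI fq] := box_vertex mI qI; exists f => //.
by apply/negP => /boxP/(_ (tag q)); rewrite fq !inE eqxx.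
Qed.

Lemma box_neq0 I : meets_blocks I -> exists f, f \in box I.
Proof.
move=> /forallP mI; have [|f fI] := @vtx_ex (fun q => q \in I).
  by move=> i; have /exists_inP[q' ? /eqP] := mI i; exists q'.
by exists f; apply/boxP.
Qed.

Lemma meets_blocksS I J :
  I \subset J -> meets_blocks I -> meets_blocks J.
Proof.
move=> /subsetP s /forallP mI; apply/forallP => i.
by have /exists_inP[q /s qJ qi] := mI i; apply/exists_inP; exists q.
Qed.

Lemma meets_blocks_vtx I f : (forall i, vtx f i \in I) -> meets_blocks I.
Proof. by move=> h; apply/forallP=> i; apply/exists_inP; exists (vtx f i). Qed.

Lemma meets_blocksD1 I : meets_blocks I -> (r < #|I|)%N ->
  exists2 q, q \in I & meets_blocks (I :\ q).
Proof.
move=> /box_neq0[f /boxP fI] rI.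
pose F := [set vtx f i | i in 'I_r].
have FI : F \subset I by apply/subsetP => _ /imsetP[i _ ->].
have /card_gt0P[q] : (0 < #|I :\: F|)%N.
  by rewrite cardsD (setIidPr FI) (card_imset _ (@vtx_inj f)) card_ord subn_gt0.
rewrite inE => /andP[qF qI]; exists q => //.
apply: (@meets_blocks_vtx _ f) => i; rewrite !inE fI andbT.
by apply: contraNneq qF => <-; apply: imset_f.
Qed.

Section AffineDimensionOfBoxes.
Variables (R : realFieldType) (d : nat) (v : idx -> 'rV[R]_d).
Local Open Scope ring_scope.

(** Strip coordinates one at a time: each step passes to a proper face and loses at least one
    dimension. The cap [k.+1] reflects that only boxes with at most [k + r] coordinates are known to
    be faces. *)
Lemma affdim_box_ge k :
  (forall I, meets_blocks I -> (#|I| <= k + r)%N -> is_face v (box I)) ->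
  forall I, meets_blocks I -> (minn (#|I| - r) k.+1)%:Z <= affdim v (box I).
Proof.
move=> hf I; have [m] := ubnP #|I|; elim: m I => // m IHm I; rewrite ltnS => Im mI.
have [Ir|rI] := leqP #|I| r.
  have [f fI] := box_neq0 mI; move: (affdim_ge0 v fI).
  by rewrite (eqP (_ : #|I| - r == 0)%N) ?min0n // subn_eq0.
have [q qI mIq] := meets_blocksD1 mI rI.
have cI : #|I| = #|I :\ q|.+1 by rewrite (cardsD1 q I) qI.
have := IHm (I :\ q) _ mIq; rewrite -ltnS -cI ltnS => /(_ Im) IH.
have pr := box_proper mI qI.
have [small|big] := leqP #|I :\ q| (k + r).
  have := affdim_face_proper (hf _ mIq small) pr; lia.
have := affdim_subset v (proper_sub pr); lia.
Qed.

(** The opposite induction adds coordinates up to the whole set, gaining at least one dimension each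
    time. *)
Lemma affdim_box_le N :
  (forall I, meets_blocks I -> is_face v (box I)) ->
  affdim v setT <= #|[set: coord]|%:Z - N ->
  forall I, meets_blocks I -> affdim v (box I) <= #|I|%:Z - N.
Proof.
move=> hf hT I; have [m] := ubnP #|~: I|; elim: m I => // m IHm I;
  rewrite ltnS => Im mI.
have [->|] := eqVneq I setT.
  rewrite (_ : box setT = setT) //; apply/setP=> f; rewrite [RHS]inE;
    apply/boxP => i.
  by rewrite inE.
rewrite -subTset => /subsetPn[q _ qI].
have cI : #|q |: I| = #|I|.+1 by rewrite cardsU1 qI.
have mJ := meets_blocksS (subsetUr [set q] I) mI.
have := IHm (q |: I) _ mJ.
have := cardsC I; have := cardsC (q |: I); rewrite cI => c1 c2.
have -> : (#|~: (q |: I)| < m)%N by lia.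
move=> /(_ isT); have pr := box_proper mJ (setU11 q I); rewrite setU1K // in pr.
have := affdim_face_proper (hf _ mI) pr; lia.
Qed.

End AffineDimensionOfBoxes.
End Boxes.

(** * Deformed products of simplices *)

Lemma big_coord (V : Type) (x0 : V) (op : Monoid.com_law x0) (r : nat)
    (n : 'I_r -> nat) (F : DProd_coord n -> V) :
  \big[op/x0]_(q : DProd_coord n) F q =
  \big[op/x0]_(i < r) \big[op/x0]_(j < (n i).+1)
     F (Tagged (fun i => 'I_(n i).+1) j).
Proof.
rewrite (sig_big_dep xpredT (fun i => xpredT) (fun i j => F (Tagged (fun i =>
  'I_(n i).+1) j))) /=.
by apply: eq_bigr => -[].
Qed.

Section DeformedProduct.
Variables (R : realFieldType) (r : nat) (n : 'I_r -> nat).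
Implicit Types S : {set DProd_idx n}.
Local Notation idx := (DProd_idx n).
Local Notation coord := (DProd_coord n).
Implicit Types (I J : {set coord}) (f : idx) (q : coord).
Local Open Scope ring_scope.

Definition block_triangular (o : 'I_r -> nat) (C : 'I_r -> coord -> R) : Prop :=
  (forall q, 0 < C (tag q) q) /\
  (forall i q, tag q != i -> (o i <= o (tag q))%N -> C i q = 0).

(** Coordinate [(i, j)] is the slack of the facet opposite vertex [j] of factor [i]; the vertex [f]
    lies off exactly the facets [(i, f i)] when [u] is positive. *)
Definition slack_pt (u : idx -> 'I_r -> R) f : 'rV[R]_(DProd_dim n) :=
  \row_j (if vtx f (tag (enum_val j)) == enum_val j then u f (tag (enum_val j))
    else 0).

Definition coord_fun (g : coord -> R) : 'cV[R]_(DProd_dim n) :=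
  \col_j g (enum_val j).

Lemma coord_funK (c : 'cV[R]_(DProd_dim n)) :
  c = coord_fun (fun q => c (enum_rank q) 0).
Proof. by apply/colP=> j; rewrite mxE enum_valK. Qed.

Lemma slack_pt_mul u f g :
  (slack_pt u f *m coord_fun g) 0 0 = \sum_i g (vtx f i) * u f i.
Proof.
rewrite mxE (reindex (@enum_rank coord)) /=; last first.
  by exists enum_val => ? _; rewrite ?enum_rankK ?enum_valK.
under eq_bigr do rewrite !mxE enum_rankK.
rewrite big_coord /=.
apply: eq_bigr => i _; rewrite (bigD1 (f i)) //= eqxx mulrC big1 ?addr0 // => j jf.
by case: eqP => [/eqP|]; rewrite ?mul0r // /vtx eq_Tagged /= eq_sym (negPf jf).
Qed.

Section Realization.
Variables (o : 'I_r -> nat) (C : 'I_r -> coord -> R).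
Variables (b : 'I_r -> R) (u : idx -> 'I_r -> R).
Hypothesis Ctri : block_triangular o C.
Hypothesis u_gt0 : forall f i, 0 < u f i.
Hypothesis uE : forall f i, \sum_j C i (vtx f j) * u f j = b i.

Definition vertex_mx f : 'M[R]_r := \matrix_(i, j) C i (vtx f j).

(** The matrix is triangular for the order by level: in a kernel vector, a nonzero entry of maximal
    level [o i] is alone in column [i], against a positive diagonal entry. *)
Lemma vertex_mx_unit f : vertex_mx f \in unitmx.
Proof.
rewrite -row_free_unit; apply: inj_row_free => y y0.
apply/rowP => i; rewrite mxE; apply/eqP; apply: contraT => yi.
case: (@arg_maxnP _ i (fun i => y 0 i != 0) o yi) => {yi}i yi imax.
move/rowP/(_ i): y0; rewrite !mxE (bigD1 i) //= big1 ?addr0.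
  move=> /eqP; rewrite mxE mulf_eq0 (negPf yi) /=.
  by have [/(_ (vtx f i)) /lt0r_neq0 /negPf /= ->] := Ctri.
move=> j ji; rewrite mxE; have [->|yj] := eqVneq (y 0 j) 0; first by rewrite mul0r.
by have [_ ->] := Ctri; rewrite ?mulr0 //= 1?eq_sym //; apply: imax.
Qed.

(* Modulo the [C i], a functional maximal at [f] becomes [- mu] with [mu = 0]
   on the coordinates of [f]; maximality against the neighbours [upd f q]
   gives [mu >= 0], so its maximal face is the box of the zeros of [mu]. *)
Lemma slack_pt_face S :
  is_face (slack_pt u) S <->
  S = set0 \/ exists2 I, meets_blocks I & S = box I.
Proof.
split=> [[c [e he]]|[->|[I mI ->]]]; first last.
- exists (coord_fun (fun q => - (q \notin I)%:R)), 0 => f; rewrite slack_pt_mul.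
  have h0 i : (vtx f i \notin I)%:R * u f i >= 0 by rewrite mulr_ge0 ?ler0n ?ltW.
  under eq_bigr do rewrite mulNr; rewrite sumrN oppr_le0; split;
    first exact: sumr_ge0.
  split=> [/boxP fI|/eqP].
    by rewrite big1 ?oppr0 // => i _; rewrite fI mul0r.
  rewrite oppr_eq0 psumr_eq0 // => /allP h; apply/boxP => i.
  by have := h i (mem_index_enum _);
    rewrite mulf_eq0 (gt_eqF (u_gt0 f i)) orbF pnatr_eq0 eqb0 negbK.
- exists 0, 1 => f; rewrite mulmx0 mxE; split; first exact: ler01.
  by rewrite inE; split=> // /eqP; rewrite eq_sym oner_eq0.
have [->|/set0Pn[f fS]] := eqVneq S set0; first by left.
right.
pose g q := c (enum_rank q) 0.
pose y : 'rV[R]_r := (\row_i g (vtx f i)) *m invmx (vertex_mx f).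
pose mu q := \sum_i y 0 i * C i q - g q.
have mu_f i : mu (vtx f i) = 0.
  have : (y *m vertex_mx f) 0 i = g (vtx f i) by rewrite mulmxKV ?vertex_mx_unit
    // mxE.
  rewrite /mu mxE => <-; apply/eqP; rewrite subr_eq0; apply/eqP.
  by apply: eq_bigr => j _; congr (_ * _); rewrite mxE.
have muE h : \sum_i mu (vtx h i) * u h i = \sum_i y 0 i * b i - (slack_pt u h *m
  c) 0 0.
  rewrite [c in RHS]coord_funK slack_pt_mul.
  under eq_bigr do rewrite mulrBl; rewrite sumrB; congr (_ - _).
  under eq_bigr do rewrite mulr_suml; rewrite exchange_big /=;
    apply: eq_bigr => i _.
  by rewrite -(uE h) mulr_sumr; apply: eq_bigr => j _; rewrite mulrA.
have eE : \sum_i y 0 i * b i = e.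
  have := muE f; rewrite big1 => [/eqP|i _]; last by rewrite mu_f mul0r.
  by rewrite eq_sym subr_eq0 => /eqP ->; have [_ [-> //]] := he f.
have mu_ge0 q : 0 <= mu q.
  have := muE (upd f q); rewrite (bigD1 (tag q)) //= vtx_upd big1 ?addr0.
    move=> h; rewrite -(pmulr_lge0 _ (u_gt0 (upd f q) (tag q))) h eE subr_ge0.
    by have [] := he (upd f q).
  by move=> i iq; rewrite vtx_upd_neq // mu_f mul0r.
exists [set q | mu q == 0].
  by apply: (@meets_blocks_vtx _ _ _ f) => i; rewrite inE mu_f.
apply/setP => h; have [_ hS] := he h.
have h0 i : 0 <= mu (vtx h i) * u h i by apply: mulr_ge0 (mu_ge0 _) (ltW _).
apply/idP/boxP => [/hS hh i|hh].
  have /eqP := muE h;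
    rewrite hh eE subrr psumr_eq0 // => /allP/(_ i (mem_index_enum _)).
  by rewrite inE mulf_eq0 (gt_eqF (u_gt0 h i)) orbF.
apply/hS; have := muE h; rewrite big1 ?eE; first by move/eqP;
  rewrite eq_sym subr_eq0 => /eqP.
by move=> i _; have := hh i; rewrite inE => /eqP ->; rewrite mul0r.
Qed.

(** The [r] columns of [K] are affine equations satisfied by all points. They are independent, since
    restricting to the coordinates of a single vertex gives the transpose of an invertible
    [vertex_mx]. *)
Lemma affdim_slack_pt : affdim (slack_pt u) setT <= #|[set: coord]|%:Z - r%:Z.
Proof.
pose Cm : 'M[R]_(DProd_dim n, r) := \matrix_(j, i) C i (enum_val j).
pose K : 'M[R]_(DProd_dim n + 1, r) := col_mx Cm (- \row_i b i).
have CmE i : col i Cm = coord_fun (C i) by apply/colP => j; rewrite !mxE.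
have K0 : homog_mx (slack_pt u) setT *m K = 0.
  apply/row_matrixP => i; rewrite row_mul rowK inE row0.
  rewrite mul_row_col mul1mx; apply/rowP => j.
  transitivity ((slack_pt u (enum_val i) *m col j Cm) 0 0 - b j).
    by rewrite colE mulmxA -colE !mxE; congr (_ - _); apply: eq_bigr => l _;
      rewrite !mxE.
  by rewrite CmE slack_pt_mul uE subrr mxE.
have rK : (r <= \rank K)%N.
  pose f0 : idx := [ffun i => ord0].
  pose Sel : 'M[R]_(r, DProd_dim n + 1) :=
    row_mx (\matrix_(i, j) (enum_val j == vtx f0 i)%:R) 0.
  suff h : Sel *m K = (vertex_mx f0)^T.
    have := mxrankM_maxr Sel K;
      rewrite h mxrank_tr (mxrank_unit (vertex_mx_unit f0)).
    by [].
  rewrite mul_row_col mul0mx addr0; apply/matrixP=> i j; rewrite !mxE.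
  rewrite (bigD1 (enum_rank (vtx f0 i))) //= !mxE enum_rankK eqxx mul1r big1
    ?addr0 //.
  move=> l li; rewrite !mxE; case: eqP => [e|]; last by rewrite mul0r.
  by rewrite -e enum_valK eqxx in li.
have := mulmx0_rank_max K0; rewrite affdim_rank cardsT -/(DProd_dim n); lia.
Qed.

End Realization.

Lemma DProd_pt_slack f : @DProd_pt R r n f = slack_pt (fun _ _ => 1) f.
Proof.
apply/rowP => j; rewrite !mxE; case: (enum_val j) => i a /=.
by rewrite /vtx eq_Tagged /= -val_eqE; case: ifP.
Qed.

End DeformedProduct.

(** * A criterion in terms of spaces of functions *)

Section Criterion.
Variables (R : realFieldType) (r : nat) (n : 'I_r -> nat).
Local Notation idx := (DProd_idx n).
Local Notation coord := (DProd_coord n).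
Implicit Types (S : {set idx}) (I J : {set coord}) (f : idx) (q : coord).
Local Open Scope ring_scope.

(* The right-hand sides [b] are chosen level by level, each large enough to
   dominate all contributions of the lower levels. *)
Lemma slack_solution (o : 'I_r -> nat) (C : 'I_r -> coord -> R) :
  block_triangular o C ->
  exists (u : idx -> 'I_r -> R) (b : 'I_r -> R),
    (forall f i, 0 < u f i) /\
    (forall f i, \sum_j C i (vtx f j) * u f j = b i).
Proof.
move=> [C_gt0 C_eq0].
have h m : exists (u : idx -> 'I_r -> R) (b : 'I_r -> R),
    forall f i, (o i < m)%N -> 0 < u f i /\
      C i (vtx f i) * u f i + \sum_(j | (o j < o i)%N) C i (vtx f j) * u f j = b i.
  elim: m => [|m [u [b IH]]]; first by exists (fun _ _ => 0), (fun _ => 0).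
  pose s f i := \sum_(j | (o j < o i)%N) C i (vtx f j) * u f j.
  pose b' i := if (o i < m)%N then b i else 1 + \sum_f `|s f i|.
  pose u' f i := if (o i < m)%N then u f i else (b' i - s f i) / C i (vtx f i).
  have s_lt f i : s f i < 1 + \sum_f `|s f i|.
    rewrite (bigD1 f) //= (le_lt_trans (ler_norm _)) // addrCA ltrDl.
    by rewrite ltr_wpDr // sumr_ge0.
  exists u', b' => f i; rewrite ltnS => oi.
  have -> : \sum_(j | (o j < o i)%N) C i (vtx f j) * u' f j = s f i.
    by apply: eq_bigr => j ji; rewrite /u' (leq_trans ji oi).
  rewrite /u' /b'; case: (ltnP (o i) m) => [/(IH f)//|_].
  have Ci : 0 < C i (vtx f i) by exact: (C_gt0 (vtx f i)).
  split; first by apply: divr_gt0 => //; rewrite subr_gt0; apply: s_lt.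
  by rewrite mulrC divfK ?subrK // gt_eqF.
have [u [b hub]] := h (\max_i o i).+1; exists u, b.
have lt i : (o i < (\max_i o i).+1)%N by rewrite ltnS leq_bigmax.
split=> f i; have [// u0 <-] := hub f i (lt i).
rewrite (bigD1 i) //=; congr (_ + _).
rewrite big_mkcond [RHS]big_mkcond; apply: eq_bigr => j _.
have [->|ji] := eqVneq j i; first by rewrite ltnn.
by case: ltnP => //= oij; rewrite C_eq0 ?mul0r.
Qed.

(** The lower dimension bound excludes boxes with more than [k + r] coordinates, and the upper bound
    admits the others. The skeleton thus does not depend on the realization. *)
Lemma skel_face_boxes d (v : idx -> 'rV[R]_d) (k : nat) S :
  (forall S, is_face v S -> S = set0 \/ exists2 I, meets_blocks I & S = box I) ->
  (forall I, meets_blocks I -> (#|I| <= k + r)%N -> is_face v (box I)) ->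
  (forall I, meets_blocks I -> affdim v (box I) <= #|I|%:Z - r%:Z) ->
  skel_face v k%:Z S <->
  S = set0 \/ exists2 I, meets_blocks I & (#|I| <= k + r)%N /\ S = box I.
Proof.
move=> hS hI hd; split=> [[/hS[->|[I mI ->]] dS]|[->|[I mI [Ik ->]]]].
- by left.
- right; exists I => //; split=> //.
  have := affdim_box_ge hI mI; lia.
- split; last by rewrite affdim_set0; lia.
  exists 0, 1 => f; rewrite mulmx0 mxE; split; first exact: ler01.
  by rewrite inE; split=> // /eqP; rewrite eq_sym oner_eq0.
- by split; [exact: hI|have := hd I mI; lia].
Qed.

Lemma is_face_ext d (v v' : idx -> 'rV[R]_d) S :
  v =1 v' -> is_face v S <-> is_face v' S.
Proof.
by move=> e; split=> -[c [b h]]; exists c, b => x; have := h x; rewrite e.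
Qed.

Lemma affdim_ext d (v v' : idx -> 'rV[R]_d) S :
  v =1 v' -> affdim v S = affdim v' S.
Proof.
move=> e; rewrite !affdim_rank (_ : homog_mx v S = homog_mx v' S) //.
by apply/row_matrixP => i; rewrite !rowK e.
Qed.

Lemma indicator_block_triangular :
  block_triangular (fun _ => 0%N) (fun i (q : coord) => (tag q == i)%:R : R).
Proof.
by split=> [q|i q /negPf ->] //; rewrite eqxx ltr01.
Qed.

Lemma indicator_vertex f i : \sum_j (tag (vtx f j) == i)%:R * 1 = 1 :> R.
Proof.
rewrite (bigD1 i) //= eqxx mulr1 big1 ?addr0 // => j /negPf ji.
by rewrite ji mul0r.
Qed.

Lemma DProd_pt_face S :
  is_face (@DProd_pt R r n) S <->
  S = set0 \/ exists2 I, meets_blocks I & S = box I.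
Proof.
rewrite (is_face_ext _ (@DProd_pt_slack R r n)).
apply: (slack_pt_face indicator_block_triangular _ indicator_vertex) => f i.
exact: ltr01.
Qed.

Lemma affdim_DProd_pt : affdim (@DProd_pt R r n) setT <= #|[set: coord]|%:Z - r%:Z.
Proof.
rewrite (affdim_ext _ (@DProd_pt_slack R r n)).
exact: (affdim_slack_pt indicator_block_triangular indicator_vertex).
Qed.

(** Pairing such a [g] with positive slacks gives a functional that is nonnegative on all points and
    zero exactly on [box I]. *)
Definition zero_set (g : coord -> R) I : Prop :=
  forall q, 0 <= g q /\ (g q == 0) = (q \in I).

Definition spanned (J : finType) (G : {set J}) (phi : J -> coord -> R) (g : coord
  -> R) :=
  exists y : J -> R, forall q, g q = \sum_(j in G) y j * phi j q.

(** Each [C i] has the constant value [b i] on the points, so factoring it out of the span loses no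
    supporting inequality and saves [r] dimensions in total. *)
Lemma delta_pr_le_spanned (k D : nat) (J : finType) (G : {set J})
    (phi : J -> coord -> R) (o : 'I_r -> nat) (C : 'I_r -> coord -> R) :
  (#|G| <= D + r)%N ->
  block_triangular o C -> (forall i, spanned G phi (C i)) ->
  (forall I, meets_blocks I -> (#|I| <= k + r)%N ->
     exists2 g, spanned G phi g & zero_set g I) ->
  delta_pr_le R k n D.
Proof.
move=> GD Ctri CG hI.
have [u [b [u_gt0 uE]]] := slack_solution Ctri.
pose V : 'M[R]_(#|G|, DProd_dim n) := \matrix_(a, j) phi (enum_val a) (enum_val j).
have VP g : spanned G phi g -> ((coord_fun g)^T <= V)%MS.
  move=> [y yE]; apply/submxP; exists (\row_a y (enum_val a)).
  by apply/rowP => j; rewrite !mxE yE big_enum_val; apply: eq_bigr => a _;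
    rewrite !mxE.
pose Cm : 'M[R]_(r, DProd_dim n) := \matrix_(i, j) C i (enum_val j).
have CV : (Cm <= V)%MS.
  apply/row_subP => i; rewrite (_ : row i Cm = (coord_fun (C i))^T);
    first exact: VP.
  by apply/rowP => j; rewrite !mxE.
have rC : \rank Cm = r.
  pose f0 : idx := [ffun i => ord0].
  apply/eqP; rewrite eqn_leq rank_leq_row /=.
  pose Sel : 'M[R]_(DProd_dim n, r) := \matrix_(j, i) (enum_val j == vtx f0 i)%:R.
  suff e : Cm *m Sel = vertex_mx C f0.
    by have := mxrankM_maxl Cm Sel;
      rewrite e (mxrank_unit (vertex_mx_unit Ctri f0)).
  apply/matrixP => i j; rewrite !mxE (bigD1 (enum_rank (vtx f0 j))) //= !mxE.
  rewrite enum_rankK eqxx mulr1 big1 ?addr0 // => l li; rewrite !mxE.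
  by case: eqP => [e|]; [rewrite -e enum_valK eqxx in li|rewrite mulr0].
(* The rows of [W] span a complement of the [C i] in the span; its rank, at most [#|G| - r], is the
   target dimension. *)
pose W := row_base (V :\: Cm)%MS.
exists (\rank (V :\: Cm)%MS); split.
  have := mxrank_cap_compl V Cm; have := rank_leq_row V.
  by rewrite (capmx_idPr CV) rC; lia.
exists (DProd_dim n), idx, (slack_pt u), W^T.
have wf := slack_pt_face Ctri u_gt0 uE.
have Af I : meets_blocks I -> (#|I| <= k + r)%N ->
    is_face (fun x => slack_pt u x *m W^T) (box I).
  move=> mI Ik; have [g gG gI] := hI I mI Ik.
  have : ((coord_fun g)^T <= Cm + W)%MS.
    apply: submx_trans (VP g gG) _.
    rewrite (adds_eqmx (eqmx_refl Cm) (eq_row_base _)) addsmxC.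
    by rewrite -{1}(addsmx_diff_cap_eq V Cm) addsmxS // capmxSr.
  move=> /sub_addsmxP[[y z] /= gE].
  have {}gE : coord_fun g = Cm^T *m y^T + W^T *m z^T.
    by rewrite -!trmx_mul -raddfD /= -gE trmxK.
  (* The [C i] part of [g] contributes the constant [\sum_i y 0 i * b i], so on projected points
     [- z^T] is this constant minus the nonnegative pairing with [g]. *)
  exists (- z^T), (\sum_i y 0 i * b i) => f.
  have CmE : slack_pt u f *m Cm^T = \row_i b i.
    apply/rowP => i; rewrite [in RHS]mxE -(uE f i) -slack_pt_mul !mxE.
    by apply: eq_bigr => j _; rewrite !mxE.
  have -> : (slack_pt u f *m W^T *m - z^T) 0 0 =
      \sum_i y 0 i * b i - \sum_i g (vtx f i) * u f i.
    rewrite -slack_pt_mul gE mulmxDr !mulmxA CmE mulmxN [in RHS]mxE opprD addrA.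
    rewrite [X in _ = _ - X + _]mxE [X in _ = _ - X + _](eq_bigr (fun i => y 0 i
      * b i)).
      by rewrite subrr add0r mxE.
    by move=> i _; rewrite !mxE mulrC.
  have h0 i : 0 <= g (vtx f i) * u f i by rewrite mulr_ge0 ?(ltW (u_gt0 _ _)) //;
    case: (gI (vtx f i)).
  move: (\sum_i y 0 i * b i) => B; rewrite gerBl sumr_ge0 //; split=> //.
  split=> [/boxP fI|/eqP].
    rewrite big1 ?subr0 // => i _; have [_] := gI (vtx f i).
    by rewrite fI => /eqP ->; rewrite mul0r.
  rewrite -subr_eq0 addrAC subrr add0r oppr_eq0 psumr_eq0 // => /allP h.
  apply/boxP => i; have := h i (mem_index_enum _).
  by rewrite /= mulf_eq0 (gt_eqF (u_gt0 f i)) orbF; have [_ ->] := gI (vtx f i).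
(* Upper dimension bounds for the deformed and the standard product. Projection can only lower the
   first, so both skeleta consist of the same boxes and the identity is an isomorphism. *)
have wd := affdim_box_le (fun I mI => (wf _).2 (or_intror (ex_intro2 _ _ I mI
  erefl)))
  (affdim_slack_pt Ctri uE).
have pd := affdim_box_le
  (fun I mI => (@DProd_pt_face _).2 (or_intror (ex_intro2 _ _ I mI erefl)))
  affdim_DProd_pt.
split.
  exists id; split=> //.
  - by move=> S /wf/DProd_pt_face.
  - by move=> S /DProd_pt_face/wf Sf; exists S.
have iff S : skel_face (fun x => slack_pt u x *m W^T) k%:Z S <->
    skel_face (@DProd_pt R r n) k%:Z S.
  rewrite !skel_face_boxes //.
  - by move=> S' /DProd_pt_face.
  - by move=> I mI _; apply/DProd_pt_face; right; exists I.
  - move=> S' [c [e h]]; apply/wf; exists (W^T *m c), e => x.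
    by rewrite mulmxA; apply: h.
  - by move=> I mI; apply: le_trans (wd I mI); apply: affdim_mulmx.
exists id; split=> //.
- by move=> S /iff.
- by move=> S /iff Sf; exists S.
Qed.
End Criterion.

(** * Polynomials and perturbation *)

Section Polynomials.
Variable R : realFieldType.
Local Open Scope ring_scope.

Lemma horner_gt0_near0 (p : {poly R}) : 0 < p.[0] ->
  exists2 d, 0 < d & forall e, 0 < e < d -> 0 < p.[e].
Proof.
elim/poly_ind: p => [|p c _]; first by rewrite horner0 ltxx.
rewrite !hornerE => c0.
(* With [p] bounded by [B] on the unit interval, [p.[e] * e + c] is positive once [e * (B + 1) < c];
   the added 1 keeps the divisor positive. *)
have [B pB] := poly_itv_bound p 0 1.
have B0 : 0 <= B by apply: le_trans (pB 0 _); rewrite ?normr_ge0 ?lexx ?ler01.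
have d0 : 0 < c / (B + 1) by rewrite divr_gt0 // ltr_wpDl.
exists (Num.min 1 (c / (B + 1))); first by rewrite lt_min ltr01.
move=> e; rewrite lt_min => /and3P[e0 e1 eB]; rewrite !hornerE.
have := pB e; rewrite (ltW e0) (ltW e1) => /(_ isT);
  rewrite ler_norml => /andP[pl _].
have : e * (B + 1) < c by rewrite -ltr_pdivlMr // ltr_wpDl.
nra.
Qed.

Lemma near0_all (T : finType) (P : T -> R -> Prop) :
  (forall x, exists2 d, 0 < d & forall e, 0 < e < d -> P x e) ->
  exists2 d, 0 < d & forall e, 0 < e < d -> forall x, P x e.
Proof.
move=> h; suff [d d0 hd] : exists2 d, 0 < d &
    forall e, 0 < e < d -> forall x, x \in enum T -> P x e.
  by exists d => // e ed x; apply: hd => //; rewrite mem_enum.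
elim: (enum T) => [|x l [d d0 hd]]; first by exists 1.
have [d' d'0 hd'] := h x; exists (Num.min d d'); first by rewrite lt_min d0.
move=> e; rewrite lt_min => /and3P[e0 ed ed'] y; rewrite inE => /predU1P[->|yl].
  by apply: hd'; rewrite e0.
by apply: hd => //; rewrite e0.
Qed.

Lemma size_prod_XsubC_in (T : finType) (A : {set T}) (x : T -> R) :
  size (\prod_(a in A) ('X - (x a)%:P)) = #|A|.+1.
Proof. by rewrite -big_enum size_prod_XsubC cardE. Qed.

Lemma interpolation (T : finType) (A : {set T}) (x tau : T -> R) :
  {in A &, injective x} ->
  exists2 p : {poly R}, (size p <= #|A|)%N & {in A, forall a, p.[x a] = tau a}.
Proof.
move=> xinj.
pose L a : {poly R} := \prod_(b in A :\ a) ('X - (x b)%:P).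
exists (\sum_(a in A) (tau a / (L a).[x a]) *: L a).
  apply: (leq_trans (size_sum _ _ _)); apply/bigmax_leqP => a aA.
  apply: (leq_trans (size_scale_leq _ _)).
  by rewrite /L size_prod_XsubC_in (cardsD1 a A) aA.
move=> a aA; rewrite horner_sum (bigD1 a) //= big1 ?addr0 => [|b /andP[bA ba]].
  rewrite hornerZ divfK // horner_prod; apply/prodf_neq0 => b /setD1P[ba bA].
  by rewrite hornerXsubC subr_eq0; apply: contraNneq ba => /xinj ->.
rewrite hornerZ [in X in _ * X]horner_prod (bigD1 a) /=;
  last by rewrite !inE eq_sym ba.
by rewrite hornerXsubC subrr mul0r mulr0.
Qed.

Definition sq_prod (T : finType) (A : {set T}) (x : T -> R) : {poly R} :=
  (\prod_(a in A) ('X - (x a)%:P)) ^+ 2.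

Lemma size_sq_prod T (A : {set T}) x : (size (sq_prod A x) <= (2 * #|A|).+1)%N.
Proof.
rewrite /sq_prod (leq_trans (size_poly_exp_leq _ _)) //.
by rewrite size_prod_XsubC_in mulnC.
Qed.

Lemma horner_sq_prod_ge0 T (A : {set T}) x y : 0 <= (sq_prod A x).[y].
Proof. by rewrite horner_exp sqr_ge0. Qed.

Lemma horner_sq_prod_eq0 T (A : {set T}) x y :
  ((sq_prod A x).[y] == 0) = [exists a in A, x a == y].
Proof.
rewrite horner_exp expf_eq0 /= horner_prod; apply/prodf_eq0/exists_inP => -[a aA h];
  by exists a => //; move: h; rewrite hornerXsubC subr_eq0 eq_sym.
Qed.

(* Cramer's rule keeps the perturbed solution polynomial in the parameter;
   it is scaled by the determinant so that no division occurs. *)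
Lemma perturbed_kernel (a b : nat) (L0 L1 : 'M[R]_(a, b)) (B : 'M_(b, a))
    (y0 : 'rV_a) :
  B *m L0 = 1%:M -> y0 *m L0 = 0 ->
  exists y : 'rV[{poly R}]_a,
    (forall e, map_mx (horner_eval e) y *m (L0 + e *: L1) = 0) /\
    map_mx (horner_eval 0) y = y0.
Proof.
move=> BL yL.
(* [M e] is [B *m (L0 + e *: L1)], the identity at [e = 0]. *)
pose M e : 'M[R]_b := 1%:M + e *: (B *m L1).
pose MX : 'M[{poly R}]_b := 1%:M + 'X *: map_mx polyC (B *m L1).
have ev m n e (N : 'M[R]_(m, n)) : map_mx (horner_eval e) (map_mx polyC N) = N.
  by apply/matrixP => i j; rewrite !mxE /horner_eval hornerC.
have MXe e : map_mx (horner_eval e) MX = M e.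
  by rewrite /MX raddfD /= map_mx1 map_mxZ /= {1}/horner_eval hornerX ev.
exists (\det MX *: map_mx polyC y0
        - 'X *: (map_mx polyC (y0 *m L1) *m \adj MX *m map_mx polyC B)).
have ye e : map_mx (horner_eval e) (\det MX *: map_mx polyC y0
        - 'X *: (map_mx polyC (y0 *m L1) *m \adj MX *m map_mx polyC B)) =
    \det (M e) *: y0 - e *: (y0 *m L1 *m \adj (M e) *m B).
  rewrite raddfB /= !map_mxZ /= !map_mxM /= !ev map_mx_adj -det_map_mx !MXe.
  by rewrite /horner_eval hornerX.
split=> [e|]; rewrite ye;
  last by rewrite scale0r subr0 /M scale0r addr0 det1 scale1r.
have BM : B *m (L0 + e *: L1) = M e by rewrite mulmxDr BL -scalemxAr.
rewrite mulmxBl -!scalemxAl -!mulmxA BM mul_adj_mx mulmxDr yL add0r -scalemxAr.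
by rewrite mul_mx_scalar -scalemxAr !scalerA mulrC subrr.
Qed.

End Polynomials.

(** * Polynomial function spaces *)

Section Perturbation.
Variables (R : realFieldType) (r : nat) (n : 'I_r -> nat).
Local Notation coord := (DProd_coord n).
Local Open Scope ring_scope.

(** Since evaluation on [I] is onto, vanishing on [I] can be maintained by coefficients polynomial
    in [e]; off [I], positivity at [e = 0] persists for small [e]. *)
Lemma spanned_perturb (J : finType) (phi0 phi1 : J -> coord -> R)
    (I : {set coord}) (g0 : coord -> R) :
  spanned setT phi0 g0 -> zero_set g0 I ->
  (forall tau : coord -> R,
     exists2 g, spanned setT phi0 g & {in I, g =1 tau}) ->
  exists2 d, 0 < d & forall e, 0 < e < d ->
    exists2 g, spanned setT (fun j q => phi0 j q + e * phi1 j q) g & zero_set g I.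
Proof.
move=> [z0 z0E] g0I surj.
have sumE (F : J -> R) : \sum_(j in setT) F j = \sum_(a < #|J|) F (enum_val a).
  by rewrite -big_enum_val; apply: eq_bigl => j; rewrite !inE.
pose L (phi : J -> coord -> R) : 'M[R]_(#|J|, #|I|) :=
  \matrix_(a, c) phi (enum_val a) (enum_val c).
(* The functions dual to the points of [I] supply the left inverse of [L phi0]. *)
have /fin_all_exists[z zE] (c : 'I_#|I|) : exists z : J -> R, forall c' : 'I_#|I|,
    \sum_(j in setT) z j * phi0 j (enum_val c') = (c == c')%:R.
  have [g [z zE] gI] := surj (fun q => (q == enum_val c)%:R).
  exists z => c'; rewrite -zE gI ?enum_valP // eq_sym.
  by rewrite (inj_eq enum_val_inj).
have BL : (\matrix_(c, a) z c (enum_val a)) *m L phi0 = 1%:M.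
  apply/matrixP => c c'; rewrite !mxE -zE sumE.
  by apply: eq_bigr => a _; rewrite !mxE.
have yL : (\row_a z0 (enum_val a)) *m L phi0 = 0.
  apply/rowP => c; have [_] := g0I (enum_val c).
  rewrite enum_valP z0E sumE => /eqP h; rewrite !mxE -[RHS]h.
  by apply: eq_bigr => a _; rewrite !mxE.
have [y [yE y0]] := perturbed_kernel (L phi1) BL yL.
(* The value at [q] of the perturbed combination, as a polynomial in [e]. *)
pose P q : {poly R} := \sum_a y 0 a *
  ((phi0 (enum_val a) q)%:P + 'X * (phi1 (enum_val a) q)%:P).
have PE q e : (P q).[e] =
    \sum_a (y 0 a).[e] * (phi0 (enum_val a) q + e * phi1 (enum_val a) q).
  by rewrite horner_sum; apply: eq_bigr => a _; rewrite !hornerE.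
have P0 q : (P q).[0] = g0 q.
  rewrite PE z0E sumE; apply: eq_bigr => a _; rewrite mul0r addr0.
  by move/rowP/(_ a): y0; rewrite !mxE /horner_eval => ->.
have PI q e : q \in I -> (P q).[e] = 0.
  move=> qI; have /rowP/(_ (enum_rank_in qI q)) := yE e; rewrite !mxE => h.
  rewrite PE -[RHS]h; apply: eq_bigr => a _.
  by rewrite !mxE enum_rankK_in // /horner_eval.
have [|d d0 hd] := @near0_all R coord (fun q e => q \notin I -> 0 < (P q).[e]).
  move=> q; have [qI|qI] := boolP (q \in I); first by exists 1.
  have [|d d0 hd] := @horner_gt0_near0 R (P q).
    by have [g0q g0z] := g0I q; rewrite P0 lt0r g0z qI.
  by exists d => // e ed _; apply: hd.
exists d => // e /hd {}hd; exists (fun q => (P q).[e]).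
  exists (fun j => (y 0 (enum_rank j)).[e]) => q; rewrite PE sumE.
  by apply: eq_bigr => a _; rewrite enum_valK.
move=> q; have [qI|qI] := boolP (q \in I); first by rewrite PI // eqxx.
by have := hd q qI; split; [exact: ltW|exact: gt_eqF].
Qed.

End Perturbation.

(** * Polynomial generators for a product with [s] segments *)

Section Construction.
Variables (R : realFieldType) (k r s : nat) (n : 'I_r -> nat).
Hypothesis le_sr : (s <= r)%N.
Hypothesis n_seg : forall i : 'I_r, (i < s)%N -> n i = 1%N.
Local Notation coord := (DProd_coord n).
Local Notation m := (2 * (k + r - s))%N.
Implicit Types (I : {set coord}) (q : coord) (i : 'I_r).
Local Open Scope ring_scope.

Definition seg q : bool := (tag q < s)%N.
Definition fst_end i : coord := Tagged (fun i => 'I_(n i).+1) (ord0 : 'I_(n i).+1).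
Definition snd_end i : coord := Tagged (fun i => 'I_(n i).+1) (ord_max : 'I_(n
  i).+1).

Lemma fst_snd_neq i : (i < s)%N -> (fst_end i == snd_end i) = false.
Proof. by move=> /n_seg ni; rewrite eq_Tagged /= -val_eqE /= ni. Qed.

Lemma segP q : seg q -> q = fst_end (tag q) \/ q = snd_end (tag q).
Proof.
case: q => i j; rewrite /seg /= => /n_seg ni.
have [j0|j0] := eqVneq (val j) 0%N; [left|right].
  by congr (Tagged _ _); apply: val_inj.
by congr (Tagged _ _); apply: val_inj; have := ltn_ord j; move: j0 => /=; lia.
Qed.

(* The last block lies to the right of all others, so that a monic polynomial
   vanishing at the other abscissas is positive on it. *)
Definition abscissa q : nat :=
  if seg q then nat_of_ord (tag q)
  else (r + enum_rank q + (if (tag q).+1 == r then #|{: coord}| else 0))%N.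

Lemma abscissa_inj q q' : abscissa q = abscissa q' ->
  q = q' \/ [/\ seg q, seg q' & tag q = tag q'].
Proof.
rewrite /abscissa; have h (p : coord) : (tag p < r)%N by [].
have h' (p : coord) : (enum_rank p < #|{: coord}|)%N by [].
have [sq|sq] := boolP (seg q); have [sq'|sq'] := boolP (seg q').
- by move=> e; right; split=> //; apply: val_inj.
- by have := h q; case: ifP => _; lia.
- by have := h q'; case: ifP => _; lia.
move=> e; left;
  suff /val_inj/enum_rank_inj : nat_of_ord (enum_rank q) = enum_rank q' by [].
move: e (h' q) (h' q');
  move: (nat_of_ord (enum_rank q)) (nat_of_ord (enum_rank q')).
by move=> a b; move: #|{: coord}| => c; do 2 case: ifP => _; lia.
Qed.

Definition X q : R := (abscissa q)%:R.

Lemma X_inj q q' : X q = X q' -> q = q' \/ [/\ seg q, seg q' & tag q = tag q'].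
Proof. by move/eqP; rewrite eqr_nat => /eqP; apply: abscissa_inj. Qed.

Lemma X_seg q q' : seg q -> tag q = tag q' -> X q = X q'.
Proof.
by rewrite /X /abscissa => sq e; rewrite sq /seg -e ifT.
Qed.

Definition sgn q : R := if seg q && (q == fst_end (tag q)) then -1 else 1.

Lemma sgn_fst i : (i < s)%N -> sgn (fst_end i) = -1.
Proof. by move=> si; rewrite /sgn /seg /= si eqxx. Qed.

Lemma sgn_snd i : sgn (snd_end i) = 1.
Proof. by rewrite /sgn /seg /=; case: ltnP => //= /fst_snd_neq;
  rewrite eq_sym => ->. Qed.

Lemma sgn_nseg q : ~~ seg q -> sgn q = 1.
Proof. by rewrite /sgn => /negPf ->. Qed.

(* Coefficient j + 1 of the second summand belongs to block j; coefficient 0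
   only enters through the perturbation, where block j is coupled to block
   j - 1. *)
Definition gens_main (j : 'I_m.+1 + 'I_r.+1) q : R :=
  match j with
  | inl e => X q ^+ e
  | inr j => sgn q * (val j == (tag q).+1)%:R
  end.

Definition gens_shift (j : 'I_m.+1 + 'I_r.+1) q : R :=
  match j with
  | inl _ => 0
  | inr j => (seg q && (val j == tag q))%:R
  end.

Definition gens (e : R) (j : 'I_m.+1 + 'I_r.+1) q : R :=
  gens_main j q + e * gens_shift j q.

(** All monomials are kept, while [a] selects corrections; the correction of block [i] has index
    [lift ord0 i]. *)
Definition gens_set (a : pred 'I_r.+1) : {set 'I_m.+1 + 'I_r.+1} :=
  [set j | if j is inr i then a i else true].

Lemma card_gens_set a : #|gens_set a| = (m.+1 + #|a|)%N.
Proof.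
rewrite -sum1_card big_sumType /= -[in RHS](sum1_card a).
rewrite [X in (X + _)%N](_ : _ = m.+1); last first.
  by rewrite (eq_bigl xpredT) ?sum1_card ?card_ord // => j; rewrite inE.
by congr addn; apply: eq_bigl => j; rewrite inE.
Qed.

(** The coefficients are those of [p] and [beta]. Block [i] reads [beta] at [i.+1] in its main term
    and, if it is a segment, at [i] in the perturbation. *)
Lemma spanned_gens (a : pred 'I_r.+1) e (p : {poly R}) (beta : nat -> R) :
  (size p <= m.+1)%N -> (forall j : 'I_r.+1, ~~ a j -> beta j = 0) ->
  spanned (gens_set a) (gens e)
    (fun q => p.[X q] + sgn q * beta (tag q).+1
              + e * (if seg q then beta (tag q) else 0)).
Proof.
move=> sp hbeta.
exists (fun j : 'I_m.+1 + 'I_r.+1 => match j with inl j => p`_j | inr j => beta j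
  end) => q.
rewrite big_sumType /= -addrA; congr (_ + _).
  rewrite (eq_bigl xpredT) => [|j]; last by rewrite inE.
  rewrite (horner_coef_wide _ sp); apply: eq_bigr => j _.
  by rewrite /gens /= mulr0 addr0.
rewrite (eq_bigl a) => [|j]; last by rewrite inE.
rewrite big_mkcond /= (eq_bigr (fun j : 'I_r.+1 => beta j * gens e (inr j) q));
  last first.
  by move=> j _; case: ifPn => // /hbeta ->; rewrite mul0r.
have delta (t : nat) : (t < r.+1)%N -> \sum_(j < r.+1) beta j * (val j == t)%:R =
  beta t.
  move=> tr; rewrite (bigD1 (Ordinal tr)) //= eqxx mulr1 big1 ?addr0 // => j jt.
  by rewrite (_ : _ == _ = false) ?mulr0 //; apply/negbTE; rewrite -val_eqE in jt.
rewrite -(delta (tag q).+1) ?ltnS // mulr_sumr.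
rewrite (_ : (if seg q then beta (tag q) else 0) =
             \sum_(j < r.+1) beta j * (seg q && (val j == tag q))%:R); last first.
  case: (seg q); first by rewrite delta // ltnW // ltnS.
  by rewrite big1 // => j _; rewrite mulr0.
by rewrite mulr_sumr -big_split; apply: eq_bigr => j _; rewrite /gens /=; ring.
Qed.

Lemma eq_spanned (J : finType) (G : {set J}) (phi phi' : J -> coord -> R) g g' :
  phi =2 phi' -> g =1 g' -> spanned G phi g -> spanned G phi' g'.
Proof.
move=> ephi eg [y yE]; exists y => q; rewrite -eg yE.
by apply: eq_bigr => j _; rewrite ephi.
Qed.

Definition shift_seq (alpha : 'I_r -> R) (j : nat) : R :=
  if j is j'.+1 then (if insub j' is Some i then alpha i else 0) else 0.

Lemma shift_seqS alpha i : shift_seq alpha i.+1 = alpha i.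
Proof. by rewrite /shift_seq valK. Qed.

Lemma spanned_gens0 (a : pred 'I_r.+1) (p : {poly R}) (alpha : 'I_r -> R) :
  (size p <= m.+1)%N -> (forall i, ~~ a (lift ord0 i) -> alpha i = 0) ->
  spanned (gens_set a) (gens 0) (fun q => p.[X q] + sgn q * alpha (tag q)).
Proof.
move=> sp h;
  apply: eq_spanned (spanned_gens 0 (beta := shift_seq alpha) sp _) => //.
  by move=> q; rewrite shift_seqS mul0r addr0.
by move=> j; case: (unliftP ord0 j) => [i ->|->] // /h; rewrite lift0 shift_seqS.
Qed.

(* At least one coordinate of each segment is left out: a segment counts only
   if both of its ends lie in [I]. *)
Definition nodes_in I : {set coord} :=
  [set q in I | ~~ seg q || (q == fst_end (tag q)) && (snd_end (tag q) \in I)].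

Lemma card_nodes_in I : meets_blocks I -> (#|I| <= k + r)%N ->
  (#|nodes_in I| <= k + r - s)%N.
Proof.
move=> /forallP mI Ik.
have sub : nodes_in I \subset I by apply/subsetP => q /setIdP[].
suff : (s <= #|I :\: nodes_in I|)%N by have := subset_leq_card sub;
  rewrite cardsD (setIidPr sub); lia.
apply: (@leq_trans #|[set tag q | q in I :\: nodes_in I]|);
  last exact: leq_imset_card.
have /subset_leq_card : [set widen_ord le_sr i | i in 'I_s] \subset
    [set tag q | q in I :\: nodes_in I].
  apply/subsetP => _ /imsetP[j _ ->]; set i := widen_ord _ _.
  have si : (i < s)%N by exact: (ltn_ord j).
  apply/imsetP; have [sI|sI] := boolP (snd_end i \in I).
    exists (snd_end i) => //; rewrite !inE sI /seg /= si /=.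
    by rewrite eq_sym fst_snd_neq.
  have /exists_inP[q qI /eqP qi] := mI i; exists q => //.
  by rewrite !inE qI /seg qi si /= (negPf sI) andbF.
by rewrite card_imset ?card_ord // => x y /(congr1 val) /= /val_inj.
Qed.

Lemma X_nodes_in I q : (exists2 z, z \in nodes_in I & X z = X q) <->
  if seg q then (fst_end (tag q) \in I) && (snd_end (tag q) \in I) else q \in I.
Proof.
split=> [[z]|].
  rewrite inE => /andP[zI zc] /X_inj[<-|[sz sq <-]].
    by move: zc; case: ifP => //= sz /andP[/eqP <- ->]; rewrite zI.
  by move: zc; rewrite sq sz /= => /andP[/eqP <- ->]; rewrite zI.
case: ifP => [sq /andP[fI sI]|sq qI]; last by exists q; rewrite // inE qI sq.
exists (fst_end (tag q)); first by rewrite inE fI sI eqxx orbT.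
exact: X_seg.
Qed.

(** The square [p] vanishes on a segment only if both ends lie in [I]. If just one does, the
    correction cancels [p] there and doubles it at the other end. *)
Lemma spanned_zero_set (a : pred 'I_r.+1) I :
  (forall i, (i < s)%N -> a (lift ord0 i)) ->
  meets_blocks I -> (#|I| <= k + r)%N ->
  exists2 g, spanned (gens_set a) (gens 0) g & zero_set g I.
Proof.
move=> ha mI Ik; pose p := sq_prod (nodes_in I) X.
have p_ge0 q : 0 <= p.[X q] by exact: horner_sq_prod_ge0.
have p_eq0 q : (p.[X q] == 0) =
    if seg q then (fst_end (tag q) \in I) && (snd_end (tag q) \in I) else q \in I.
  rewrite horner_sq_prod_eq0;
    apply/exists_inP/idP => [[z zI /eqP e]|/X_nodes_in[z zI e]].
    by apply/X_nodes_in; exists z.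
  by exists z => //; apply/eqP.
pose alpha i : R := if (i < s)%N then
  ((fst_end i \in I)%:R - (snd_end i \in I)%:R) * p.[X (fst_end i)] else 0.
exists (fun q => p.[X q] + sgn q * alpha (tag q)).
  apply: spanned_gens0 => [|i].
    rewrite (leq_trans (size_sq_prod _ _)) // ltnS leq_mul2l.
    exact: card_nodes_in.
  by rewrite /alpha; case: ifP => // /ha ->.
move=> q; have [sq|sq] := boolP (seg q); last first.
  rewrite /alpha ifN // mulr0 addr0; split; first exact: p_ge0.
  by rewrite p_eq0 (negPf sq).
have /exists_inP[q' q'I /eqP q'q] := forallP mI (tag q).
have sq' : seg q' by rewrite /seg q'q.
have bI : (fst_end (tag q) \in I) || (snd_end (tag q) \in I).
  by have [] := segP sq'; rewrite q'q => <-; rewrite q'I ?orbT.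
rewrite /alpha ifT // (X_seg (q := fst_end (tag q)) (q' := q)) //.
have := p_ge0 q; have := p_eq0 q; rewrite sq.
have sX i : sgn (snd_end i) = 1 := sgn_snd i.
have fX := sgn_fst (i := tag q) sq.
suff h c : c = q -> (c == fst_end (tag q)) || (c == snd_end (tag q)) -> 
  (p.[X q] == 0) = (fst_end (tag q) \in I) && (snd_end (tag q) \in I) -> 0 <=
    p.[X q] ->
  0 <= p.[X q] + sgn c *
    (((fst_end (tag q) \in I)%:R - (snd_end (tag q) \in I)%:R) * p.[X q]) /\
  (p.[X q] + sgn c *
    (((fst_end (tag q) \in I)%:R - (snd_end (tag q) \in I)%:R) * p.[X q]) == 0) =
   (c \in I).
  by apply: h => //; have [<-|<-] := segP sq; rewrite eqxx ?orbT.
move: p.[X q] => x _ /orP[]/eqP ->; rewrite ?fX ?sX; move: bI.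
all: case: (fst_end _ \in I); case: (snd_end _ \in I) => //= _.
all: move=> x0 xge; have [xz|xz] := eqVneq x 0; move: x0;
  rewrite ?xz ?eqxx ?(negPf xz) //.
all: rewrite ?subrr ?subr0 ?sub0r ?mul0r ?mulr0 ?addr0 ?eqxx ?mulN1r ?mulNr
  ?mul1r ?mulr1 ?opprK ?subrr ?eqxx //.
all: by move=> _; split; [lra|apply: contraNF xz => /eqP ?; apply/eqP; lra].
Qed.

Lemma X_nodes_in_inj I : {in nodes_in I &, injective X}.
Proof.
move=> z z'; rewrite !inE => /andP[_ hz] /andP[_ hz'] /X_inj[//|[sz sz' e]].
move: hz hz'; rewrite sz sz' /= => /andP[/eqP -> _] /andP[/eqP -> _].
by rewrite e.
Qed.

(** If both ends of a segment lie in [I], the polynomial interpolates their mean and the correction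
    supplies half the difference. If only one does, the correction alone adjusts it. *)
Lemma spanned_values I : meets_blocks I -> (#|I| <= k + r)%N ->
  forall tau : coord -> R,
  exists2 g, spanned (gens_set xpredT) (gens 0) g & {in I, g =1 tau}.
Proof.
move=> mI Ik tau.
pose sigma q := if seg q then (tau (fst_end (tag q)) + tau (snd_end (tag q))) / 2
  else tau q.
have [p sp pE] := interpolation sigma (@X_nodes_in_inj I).
pose alpha i : R := if (i < s)%N then
  if snd_end i \in I then tau (snd_end i) - p.[X (snd_end i)]
  else p.[X (fst_end i)] - tau (fst_end i) else 0.
exists (fun q => p.[X q] + sgn q * alpha (tag q)).
  apply: spanned_gens0 => //; apply: leq_trans sp _.
  by have := card_nodes_in mI Ik; lia.
move=> q qI; rewrite /alpha; have [sq|sq] := boolP (seg q); last first.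
  by rewrite ifN // mulr0 addr0 pE /sigma ?(negPf sq) // inE qI sq.
rewrite ifT //; have [e|e] := segP sq; last first.
  by rewrite (_ : sgn q = 1) -?e ?qI; [ring|rewrite e sgn_snd].
have sX : X (snd_end (tag q)) = X q by rewrite [in RHS]e; apply/esym/X_seg;
  rewrite // -e.
have -> : sgn q = -1 by rewrite e sgn_fst.
case: ifP => sI; last by rewrite -e; ring.
have qN : q \in nodes_in I by rewrite inE qI sI -e eqxx orbT.
by have := pE q qN; rewrite /sigma sq -e sX => ->; field.
Qed.

(** The two ends of a segment share an abscissa, so one is dropped: each abscissa of the first [t]
    blocks is represented once, for [s <= t]. *)
Definition nodes_below (t : nat) : {set coord} :=
  [set q : coord | (tag q < t)%N && ~~ (seg q && (q == snd_end (tag q)))].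

Lemma X_nodes_below_inj t : {in nodes_below t &, injective X}.
Proof.
move=> z z'; rewrite !inE => /andP[_ hz] /andP[_ hz'] /X_inj[//|[sz sz' e]].
move: hz hz'; rewrite sz sz' /=; have [|->] := segP sz; last by rewrite eqxx.
by have [|->] := segP sz'; [move=> -> ->; rewrite e|rewrite eqxx].
Qed.

Lemma X_nodes_below t q : (s <= t)%N -> (tag q < t)%N ->
  exists z, [/\ z \in nodes_below t, X z = X q & tag z = tag q].
Proof.
move=> st qt; have [sq|sq] := boolP (seg q); last by exists q;
  rewrite inE qt negb_and sq.
exists (fst_end (tag q)); rewrite inE /= qt fst_snd_neq // andbF; split=> //.
exact: X_seg.
Qed.

(** Blocks below [t] take an interpolated indicator as [C i], later ones their own correction. The
    last block may instead use the monic polynomial with roots at the nodes, of degree at most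
    [m]. *)
Lemma delta_pr_le_exact (t D : nat) (a : pred 'I_r.+1) :
  (s <= t)%N -> (#|nodes_below t| <= m.+1)%N ->
  (forall i, (i < s)%N -> a (lift ord0 i)) ->
  (forall i, (t <= i)%N ->
     a (lift ord0 i) \/ i.+1 = r /\ (#|nodes_below t| <= m)%N) ->
  (m.+1 + #|a| <= D + r)%N ->
  delta_pr_le R k n D.
Proof.
move=> st tm a_seg a_big aD.
(* The interpolants are uncontrolled beyond block [t], hence the top level; the monic polynomial
   vanishes only on the first [t] blocks for sure, hence the middle one. Corrections touch no other
   block. *)
pose o i : nat := if (i < t)%N then 2%N else if i.+1 == r then 1%N else 0%N.
have /fin_all_exists[C CP] i : exists C : coord -> R,
    spanned (gens_set a) (gens 0) C /\
    (forall q, tag q = i -> 0 < C q) /\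
    (forall q, tag q != i -> (o i <= o (tag q))%N -> C q = 0).
  have [it|ti] := ltnP i t.
    have [p sp pE] := interpolation (fun q => (tag q == i)%:R)
      (@X_nodes_below_inj t).
    have pX q : (tag q < t)%N -> p.[X q] = (tag q == i)%:R.
      by move=> /(X_nodes_below st)[z [zN <- <-]]; apply: pE.
    exists (fun q => p.[X q] + sgn q * 0); split.
      by apply: (@spanned_gens0 _ _ (fun=> 0)); rewrite // (leq_trans sp).
    split=> q; rewrite mulr0 addr0.
      by move=> e; rewrite pX ?e ?eqxx ?ltr01.
    move=> qi; rewrite /o it; case: ifP => [qt _|_]; last by case: ifP.
    by rewrite pX // (negPf qi).
  have nseg q : tag q = i -> ~~ seg q by rewrite /seg => ->;
    rewrite -leqNgt (leq_trans st).
  case: (a_big i ti) => [ai|[ir tm']].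
    exists (fun q => (0 : {poly R}).[X q] + sgn q * (tag q == i)%:R); split.
      apply: (@spanned_gens0 _ _ (fun j => (j == i)%:R));
        rewrite ?size_poly0 // => j.
      by case: eqP => // ->; rewrite ai.
    split=> q; rewrite horner0 add0r.
      by move=> e; rewrite e eqxx mulr1 sgn_nseg ?ltr01 // nseg.
    by move=> /negPf ->; rewrite mulr0.
  pose p : {poly R} := \prod_(b in nodes_below t) ('X - (X b)%:P).
  exists (fun q => p.[X q] + sgn q * 0); split.
    apply: (@spanned_gens0 _ _ (fun=> 0)) => //.
    by rewrite size_prod_XsubC_in ltnS.
  split=> q; rewrite mulr0 addr0 horner_prod => e.
    apply: prodr_gt0 => z; rewrite inE => /andP[zt _].
    rewrite hornerXsubC subr_gt0 ltr_nat /abscissa (negPf (nseg q e)) e ir eqxx.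
    have zr : (tag z).+1 != r by lia.
    have := ltn_ord (enum_rank z); have := ltn_ord (tag z); rewrite (negPf zr).
    move: (nat_of_ord (enum_rank z)) (nat_of_ord (enum_rank q)) (nat_of_ord (tag
      z)).
    by move=> x y w; move: #|{: coord}| => c; case: ifP => _; lia.
  rewrite /o ltnNge ti /= ir eqxx; case: ifP => [qt _|_].
    have [z [zN zq _]] := X_nodes_below st qt.
    by apply/eqP/prodf_eq0; exists z; rewrite // hornerXsubC zq subrr.
  case: ifP => // /eqP qr _; case/eqP: e; apply: val_inj => /=; lia.
apply: (@delta_pr_le_spanned R r n k D _ (gens_set a) (gens 0) o C).
- by rewrite card_gens_set.
- split=> [q|i q].
    by have [_ [h _]] := CP (tag q); apply: h.
  by have [_ [_ h]] := CP i; apply: h.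
- by move=> i; have [] := CP i.
- by move=> I mI Ik; have [g ? ?] := spanned_zero_set a_seg mI Ik; exists g.
Qed.

(** An antisymmetric correction cannot be positive on a segment, but the term of order [e] is. All
    [r + 1] corrections are used, giving [(m + 2) + r] generators. *)
Lemma delta_pr_le_perturbed : delta_pr_le R k n (m + 2).
Proof.
pose a : pred 'I_r.+1 := xpredT.
have aT : gens_set a = setT by apply/setP => -[j|j]; rewrite !inE.
have [|d d0 hd] := @near0_all R {set coord} (fun I e =>
    meets_blocks I -> (#|I| <= k + r)%N ->
    exists2 g, spanned setT (gens e) g & zero_set g I).
  move=> I; have [mI|mI] := boolP (meets_blocks I); last by exists 1.
  have [Ik|Ik] := leqP #|I| (k + r); last by exists 1.
  have main g : spanned (gens_set a) (gens 0) g -> spanned setT gens_main g.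
    by rewrite aT; apply: eq_spanned => // j q; rewrite /gens mul0r addr0.
  have [g0 /main g0s g0I] := spanned_zero_set (a := a) (fun _ _ => isT) mI Ik.
  have [|d d0 hd] := spanned_perturb gens_shift g0s g0I.
    by move=> tau; have [g /main ? ?] := spanned_values mI Ik tau; exists g.
  by exists d => // e /hd.
pose e := d / 2.
have e0 : 0 < e by rewrite divr_gt0.
have ed : 0 < e < d by rewrite e0 /= /e; lra.
pose o i : nat := if (i < s)%N then i.+1 else 0%N.
(* For a segment, generator [i] divided by [e] is 1 on block [i] and otherwise lives on block
   [i - 1], if any, whose level is lower. For a simplex, generator [i.+1] is the indicator, the
   perturbation being confined to segments. *)
pose beta i (j : nat) : R := if (i < s)%N then (j == i)%:R / e else (j == i.+1)%:R.
pose C i q : R := (0 : {poly R}).[X q] + sgn q * beta i (tag q).+1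
              + e * (if seg q then beta i (tag q) else 0).
have CE i q : C i q = if (i < s)%N then sgn q * ((tag q).+1 == i)%:R / e + (seg q
  && (tag q == i))%:R
   else sgn q * (tag q == i)%:R.
  rewrite /C horner0 add0r /beta; case: (ltnP i s) => si.
    rewrite mulrA; congr (_ + _); case: (seg q);
      rewrite ?mulr0 //= mulrCA divff ?mulr1 //.
    by rewrite gt_eqF.
  rewrite eqSS (_ : (if _ then _ else _) = 0) ?mulr0 ?addr0 //.
  by case: ifP => // sq; rewrite ltn_eqF // ltnS ltnW // (leq_trans sq si).
apply: (@delta_pr_le_spanned R r n k (m + 2) _ setT (gens e) o C).
- by rewrite -aT card_gens_set /a card_ord; lia.
- split=> [q|i q qi]; rewrite CE.
    rewrite eqxx; have [sq|sq] := boolP (seg q); last first.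
      by rewrite ifN // sgn_nseg // mulr1 ltr01.
    by rewrite ifT // (gtn_eqF (ltnSn _)) mulr0 mul0r add0r ltr01.
  rewrite /o (negPf qi) andbF mulr0; case: ifP => // si; case: ifP => // sq oq.
  by rewrite (gtn_eqF oq) mulr0 mul0r add0r.
- move=> i; have := @spanned_gens xpredT e 0 (beta i); rewrite -/a aT size_poly0.
  by apply.
- by move=> I mI Ik; have [g ? ?] := hd e ed I mI Ik; exists g.
Qed.

End Construction.

(** * Counting *)

Lemma sum_ord_itv (N lo hi : nat) :
  \sum_(j < N) (lo <= j < hi : nat) = minn hi N - lo.
Proof.
elim: N => [|N IHN]; first by rewrite big_ord0 minn0.
rewrite big_ord_recr /= IHN; case: (leqP lo N); case: (ltnP N hi) => /=; lia.
Qed.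

Lemma card_ord_itv (N lo hi : nat) :
  #|[pred j : 'I_N | lo <= j < hi]| = minn hi N - lo.
Proof.
rewrite -sum_ord_itv -sum1_card big_mkcond.
by apply: eq_bigr => j _; rewrite inE; case: ifP.
Qed.

Lemma card_coord (r : nat) (n : 'I_r -> nat) :
  #|DProd_coord n| = \sum_(i < r) (n i).+1.
Proof.
by rewrite -sum1_card big_coord; apply: eq_bigr => i _; rewrite sum1_card card_ord.
Qed.

Lemma sum_block_sizes (r s t : nat) (n : 'I_r -> nat) (c : nat) : s <= t -> t <=
  r ->
  \sum_(i < r) (if i < s then c else if i < t then (n i).+1 else 0) =
  c * s + \sum_(i < r | (s <= i) && (i < t)) (n i).+1.
Proof.
move=> st tr.
have -> : c * s = \sum_(i < r) c * (0 <= i < s).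
  by rewrite -big_distrr sum_ord_itv; congr muln; lia.
rewrite [X in _ = _ + X]big_mkcond -big_split /=; apply: eq_bigr => i _.
by case: (ltnP i s); case: (ltnP i t); rewrite /= ?muln1 ?muln0 ?addn0.
Qed.

Lemma card_nodes_below (r s t : nat) (n : 'I_r -> nat) : s <= t -> t <= r ->
  (forall i : 'I_r, i < s -> n i = 1) ->
  #|nodes_below s n t| = s + \sum_(i < r | (s <= i) && (i < t)) (n i).+1.
Proof.
move=> st tr n1; rewrite -[X in X + _]mul1n -sum_block_sizes //.
rewrite -sum1_card big_mkcond big_coord; apply: eq_bigr => i _.
under eq_bigr do rewrite inE /seg /snd_end eq_Tagged /=.
case: (ltnP i s) => is_ /=; last first.
  by case: (ltnP i t) => it /=; [rewrite sum1_card card_ord|rewrite big1].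
rewrite (leq_trans is_ st) /= -big_mkcond sum1_card.
by rewrite (eq_card (B := predC1 ord_max)) ?cardC1 ?card_ord ?n1.
Qed.

(** With one generator per coordinate every function is available, so the undeformed indicators
    serve as the [C i]. *)
Lemma delta_pr_le_full (R : realFieldType) (k r : nat) (n : 'I_r -> nat) (D : nat) :
  #|DProd_coord n| <= D + r -> delta_pr_le R k n D.
Proof.
move=> cD.
have sp (g : DProd_coord n -> R) :
    spanned setT (fun j q : DProd_coord n => (j == q)%:R%R) g.
  exists g => q;
    rewrite (bigD1 q) ?inE //= eqxx mulr1 big1 ?addr0 // => j /andP[_ /negPf ->].
  by rewrite mulr0.
apply: (delta_pr_le_spanned _ (indicator_block_triangular R n) (fun i => sp _)).
- by rewrite cardsT.
- move=> I mI _; exists (fun q => (q \notin I)%:R%R); first exact: sp.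
  by move=> q; rewrite ler0n pnatr_eq0 eqb0 negbK.
Qed.

Theorem theorem3p6 (R : rcfType) (k r s : nat) (n : 'I_r -> nat)
  (hs : (s <= r)%N)
  (hn1 : forall i : 'I_r, (i < s)%N -> n i = 1%N)
  (hn2 : forall i : 'I_r, (s <= i)%N -> (1 < n i)%N)
  (hmono : forall i j : 'I_r, (i <= j)%N -> (n i <= n j)%N) :
  [/\ (3 * s <= 2 * k + 2 * r)%N ->
        forall t : nat, (s <= t <= r)%N -> t_cond k s n t ->
          (forall t' : nat, (s <= t' <= r)%N -> t_cond k s n t' -> (t' <= t)%N) ->
          delta_pr_le R k n (2 * (k + r) - s - t),
      (3 * s = 2 * k + 2 * r + 1)%N ->
          delta_pr_le R k n (2 * (k + r - s) + 1) &
      (2 * k + 2 * r + 2 <= 3 * s)%N ->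
          delta_pr_le R k n (2 * (k + r - s + 1))].
Proof.
split=> [_ t /andP[st tr] | e3 | _].
- rewrite /t_cond; case: (ltnP t r) => [ltr_ tc _|rt tc _].
    (* The condition on [t] says that at most [m] nodes lie below [t]. Indices being shifted by one,
       [a] keeps the segments and [b] the blocks [t] to [r - 2]; block [r - 1] uses the monic
       polynomial. *)
    pose a := [pred j : 'I_r.+1 | 1 <= j < s.+1] .
    pose b := [pred j : 'I_r.+1 | t.+1 <= j < r].
    have cA := card_nodes_below st tr hn1.
    apply: (@delta_pr_le_exact R k r s n hs hn1 t _ [predU a & b]) => //.
    + by rewrite cA; lia.
    + by move=> i si; rewrite !inE /= /bump /= add1n !ltnS si.
    + move=> i ti; rewrite !inE /= /bump /= add1n !ltnS ti /=.
      case: (ltnP i.+1 r) => ir; first by left; rewrite orbT.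
      by right; split; [have := ltn_ord i|rewrite cA]; lia.
    + have ab : #|[predU a & b]| <= s + (r - t.+1).
        have := leq_addr #|[predI a & b]| #|[predU a & b]|.
        by rewrite cardUI !card_ord_itv => /leq_trans; apply; lia.
      by apply: leq_trans (leq_add (leqnn _) ab) _; lia.
  (* Now all coordinates together number at most [2 * (k + r) - s], which is the allowed size of the
     span. *)
  have tE : t = r by lia.
  apply: delta_pr_le_full; rewrite card_coord; subst t.
  have -> : \sum_(i < r) (n i).+1 = 2 * s + \sum_(i < r | (s <= i) && (i < r)) (n
    i).+1.
    rewrite -sum_block_sizes //; apply: eq_bigr => i _.
    by rewrite ltn_ord; case: ltnP => // /hn1 ->.
  by move: (\sum_(i < r | _) _) tc => S; lia.
(* Here [m = s - 1], just enough to interpolate on the [s] segment abscissas; all [r] block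
   corrections are kept. *)
- have cA := card_nodes_below (leqnn s) hs hn1.
  rewrite big_pred0 ?addn0 in cA; last by move=> i; lia.
  apply: (@delta_pr_le_exact R k r s n hs hn1 s _ [pred j : 'I_r.+1 | 1 <= j <
    r.+1]) => //.
  + by rewrite cA; lia.
  + by move=> i _; rewrite /= /bump /= add1n !ltnS /=.
  + by move=> i _; left; rewrite /= /bump /= add1n !ltnS /=.
  + by rewrite card_ord_itv; lia.
- by rewrite mulnDr muln1; apply: delta_pr_le_perturbed.
Qed.
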